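(* Let $\alpha_V,\alpha_W\in[0,1]$. Choose the trapezoidal rule for both the slow and the fast potential: $$V_d(q_k^s,q_{k+1}^s,q_k^f)=\sum_{m=0}^{p-1}\Delta t\big(\alpha_VV(q_k^{s,m},q_k^{f,m})+(1-\alpha_V)V(q_k^{s,m+1},q_k^{f,m+1})\big),$$ $$W_d(q_k^f)=\sum_{m=0}^{p-1}\Delta t\big(\alpha_WW(q_k^{f,m})+(1-\alpha_W)W(q_k^{f,m+1})\big).$$ Then the momentum form of the discrete multirate Euler-Lagrange equations is equivalent to the following $(p,q)$-scheme (for $k=0,\dots,N-1$ and $m=0,\dots,p-1$), with slow part $$q_{k+1}^s=q_k^s+\Delta T(M^s)^{-1}\Big[p_k^s-\Delta t\Big(\sum_{m=1}^{p-1}\frac{p-m}{p}\frac{\partial V}{\partial q^s}(q_k^{s,m},q_k^{f,m})+\alpha_V\frac{\partial V}{\partial q^s}(q_k^{s,0},q_k^{f,0})\Big)\Big],$$ $$p_{k+1}^s=p_k^s-\Delta t\Big(\sum_{m=1}^{p-1}\frac{\partial V}{\partial q^s}(q_k^{s,m},q_k^{f,m})+\alpha_V\frac{\partial V}{\partial q^s}(q_k^{s,0},q_k^{f,0})+(1-\alpha_V)\frac{\partial V}{\partial q^s}(q_k^{s,p},q_k^{f,p})\Big)$$ and fast part $$q_k^{f,m+1}=q_k^{f,m}+\Delta t(M^f)^{-1}\Big[p_k^{f,m}-\Delta t\Big(\alpha_V\frac{\partial V}{\partial q^f}(q_k^{s,m},q_k^{f,m})+\alpha_W\nabla W(q_k^{f,m})\Big)\Big],$$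 $$p_k^{f,m+1}=p_k^{f,m}-\Delta t\Big[\alpha_V\frac{\partial V}{\partial q^f}(q_k^{s,m},q_k^{f,m})+\alpha_W\nabla W(q_k^{f,m})+(1-\alpha_V)\frac{\partial V}{\partial q^f}(q_k^{s,m+1},q_k^{f,m+1})+(1-\alpha_W)\nabla W(q_k^{f,m+1})\Big].$$ Equivalently, it can be written as the transformed $(p,q)$-scheme, with the same fast part and with the slow part replaced by $$\tilde p_k^s=p_k^s-\Delta t\Big(\sum_{m=1}^{p-1}\frac{p-m}{p}\frac{\partial V}{\partial q^s}(q_k^{s,m},q_k^{f,m})+\alpha_V\frac{\partial V}{\partial q^s}(q_k^{s,0},q_k^{f,0})\Big),$$ $$q_{k+1}^s=q_k^s+\Delta T(M^s)^{-1}\tilde p_k^s,$$ $$p_{k+1}^s=\tilde p_k^s-\Delta t\Big(\sum_{m=1}^{p-1}\frac{m}{p}\frac{\partial V}{\partial q^s}(q_k^{s,m},q_k^{f,m})+(1-\alpha_V)\frac{\partial V}{\partial q^s}(q_k^{s,p},q_k^{f,p})\Big).$$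
   Context: Let $Q=Q^s\times Q^f\subset\mathbb{R}^{n^s}\times\mathbb{R}^{n^f}$ be open, with slow variables $q^s$ and fast variables $q^f$. The multirate Lagrangian is $L=\tfrac12(\dot q^s)^TM^s\dot q^s+\tfrac12(\dot q^f)^TM^f\dot q^f-V(q^s,q^f)-W(q^f)$, with symmetric invertible mass matrices $M^s,M^f$ (so $L$ is regular), smooth slow potential $V$ and smooth fast potential $W$. Let $\Delta T=p\,\Delta t$, where $p\in\mathbb{N}$ (without indices) is the number of micro steps per macro step; indexed symbols $p_k^s,\ p_k^{f,m}$ denote momenta. Discrete slow configurations $q_k^s$, $k=0,\dots,N$, live on macro nodes $k\Delta T$; discrete fast configurations $q_k^{f,m}$, $k=0,\dots,N-1$, $m=0,\dots,p$, live on micro nodes $k\Delta T+m\Delta t$, with $q_{k-1}^{f,p}=q_k^{f,0}$; $q_k^f=(q_k^{f,0},\dots,q_k^{f,p})$. The slow values at micro nodes are linearly interpolated: $q_k^{s,m}=q_k^s+\tfrac{m}{p}(q_{k+1}^s-q_k^s)$, $m=0,\dots,p$. The discrete Lagrangian is $L_d=T_d-V_d-W_d$ with $$T_d=\frac{\Delta T}{2}\Big(\frac{q_{k+1}^s-q_k^s}{\Delta T}\Big)^TM^s\Big(\frac{q_{k+1}^s-q_k^s}{\Delta T}\Big)+\sum_{m=0}^{p-1}\frac{\Delta t}{2}\Big(\frac{q_k^{f,m+1}-q_k^{f,m}}{\Delta t}\Big)^TM^f\Big(\frac{q_k^{f,m+1}-q_k^{f,m}}{\Delta t}\Big).$$ It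 is written as $L_d(q_k^s,q_{k+1}^s,q_k^f)=\sum_{m=0}^{p-1}L_d^m(q_k^s,q_{k+1}^s,q_k^{f,m},q_k^{f,m+1})$, where $L_d^m$ collects the contributions of the $m$-th micro interval. The discrete multirate Euler-Lagrange equations (stationarity of $\sum_kL_d(q_k^s,q_{k+1}^s,q_k^f)$ with fixed end points) express matching of left and right discrete momenta at all macro and micro nodes. Their momentum form, with unique momenta $p_k^s$ and $p_k^{f,m}$ and $p_{k-1}^{f,p}=p_k^{f,0}$, is: for $k=0,\dots,N-1$ and $m=0,\dots,p-1$, $$p_k^s=-D_{q_k^s}L_d(q_k^s,q_{k+1}^s,q_k^f),\qquad p_{k+1}^s=D_{q_{k+1}^s}L_d(q_k^s,q_{k+1}^s,q_k^f),$$ $$p_k^{f,m}=-D_{q_k^{f,m}}L_d^m(q_k^s,q_{k+1}^s,q_k^{f,m},q_k^{f,m+1}),\qquad p_k^{f,m+1}=D_{q_k^{f,m+1}}L_d^m(q_k^s,q_{k+1}^s,q_k^{f,m},q_k^{f,m+1}),$$ where $D_*$ is the partial derivative with respect to the argument $*$ (written as a column vector). *)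

(* Defs.v *)
From HB Require Import structures.
From mathcomp Require Import all_boot all_order all_algebra.
From mathcomp Require Import all_classical all_reals all_analysis.
Set Implicit Arguments.
Unset Strict Implicit.
Unset Printing Implicit Defensive.
Import Order.TTheory GRing.Theory Num.Theory.
Import numFieldNormedType.Exports.
Local Open Scope classical_set_scope.
Local Open Scope ring_scope.

Section Calculus.
Context {R : realType}.

(* [f] is of class C^n on [U]; meant for [U] open and [E] finite-dimensional. *)
Fixpoint Cn_on (E : normedModType R) (U : set E) (n : nat) (f : E -> R) : Prop :=
  if n is n'.+1 then
    (forall x, U x -> differentiable f x) /\
    (forall v : E, Cn_on U n' (fun x => 'D_v f x))
  else forall x, U x -> {for x, continuous f}.

Definition smooth_on (E : normedModType R) (U : set E) (f : E -> R) : Prop :=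
  forall n, Cn_on U n f.

(* The column vector of partial derivatives; 'D_v is total, so this is the
   gradient only where the partial derivatives exist. *)
Definition grad (n : nat) (f : 'cV[R]_n -> R) (x : 'cV[R]_n) : 'cV[R]_n :=
  \col_(i < n) 'D_(delta_mx i 0) f x.

Definition quad (n : nat) (M : 'M[R]_n) (v : 'cV[R]_n) : R :=
  (v^T *m M *m v) 0 0.

End Calculus.

(* A discrete trajectory is given by [qs k] (macro nodes, k <= N) and [qf k m]
   (micro nodes, k < N, m <= p), and likewise for the momenta; the values of
   these functions outside of the indicated ranges play no role. *)
Section Multirate.
Context {R : realType} {ns nf : nat}.
Variables (p : nat) (dt : R).

Definition DT : R := p%:R * dt.

Definition interp (x y : 'cV[R]_ns) (m : nat) : 'cV[R]_ns :=
  x + (m%:R / p%:R) *: (y - x).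

Variables (Ms : 'M[R]_ns) (Mf : 'M[R]_nf).
Variables (V : 'cV[R]_ns * 'cV[R]_nf -> R) (W : 'cV[R]_nf -> R).
Variables (aV aW : R).

Definition dVs (x : 'cV[R]_ns) (y : 'cV[R]_nf) : 'cV[R]_ns :=
  grad (fun x' => V (x', y)) x.

Definition dVf (x : 'cV[R]_ns) (y : 'cV[R]_nf) : 'cV[R]_nf :=
  grad (fun y' => V (x, y')) y.

Section DiscreteLagrangian.
Variables (qs qs' : 'cV[R]_ns).

Definition Td (qf : nat -> 'cV[R]_nf) : R :=
  DT / 2 * quad Ms (DT^-1 *: (qs' - qs))
  + \sum_(m < p) dt / 2 * quad Mf (dt^-1 *: (qf m.+1 - qf m)).

Definition Vd (qf : nat -> 'cV[R]_nf) : R :=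
  \sum_(m < p) dt * (aV * V (interp qs qs' m, qf m)
                     + (1 - aV) * V (interp qs qs' m.+1, qf m.+1)).

Definition Wd (qf : nat -> 'cV[R]_nf) : R :=
  \sum_(m < p) dt * (aW * W (qf m) + (1 - aW) * W (qf m.+1)).

Definition Ld (qf : nat -> 'cV[R]_nf) : R := Td qf - Vd qf - Wd qf.

(* The slow velocity is constant on a macro interval, so each micro interval
   carries the share dt / DT = 1 / p of the slow kinetic energy. *)
Definition Ldm (m : nat) (y y' : 'cV[R]_nf) : R :=
  dt / 2 * quad Ms (DT^-1 *: (qs' - qs))
  + dt / 2 * quad Mf (dt^-1 *: (y' - y))
  - dt * (aV * V (interp qs qs' m, y) + (1 - aV) * V (interp qs qs' m.+1, y'))
  - dt * (aW * W y + (1 - aW) * W y').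

Lemma Ld_sum (qf : nat -> 'cV[R]_nf) :
  Ld qf = \sum_(m < p) Ldm m (qf m) (qf m.+1).
Proof.
rewrite /Ld /Td /Vd /Wd /Ldm !big_split /= !sumrN; congr (_ + _ - _ - _).
by rewrite sumr_const card_ord -[RHS]mulr_natl /DT !mulrA.
Qed.

End DiscreteLagrangian.

Variable N : nat.
Variables (qs : nat -> 'cV[R]_ns) (qf : nat -> nat -> 'cV[R]_nf).
Variables (ps : nat -> 'cV[R]_ns) (pf : nat -> nat -> 'cV[R]_nf).

Let qsm k m := interp (qs k) (qs k.+1) m.

Definition momentum_form : Prop :=
  forall k, (k < N)%N ->
  [/\ ps k = - grad (fun x => Ld x (qs k.+1) (qf k)) (qs k),
      ps k.+1 = grad (fun x => Ld (qs k) x (qf k)) (qs k.+1)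
    & forall m, (m < p)%N ->
      pf k m
        = - grad (fun y => Ldm (qs k) (qs k.+1) m y (qf k m.+1)) (qf k m) /\
      pf k m.+1
        = grad (fun y => Ldm (qs k) (qs k.+1) m (qf k m) y) (qf k m.+1)].

Definition slow_scheme : Prop :=
  forall k, (k < N)%N ->
  qs k.+1 = qs k + DT *: (invmx Ms *m (ps k - dt *:
      (\sum_(1 <= m < p) ((p%:R - m%:R) / p%:R) *: dVs (qsm k m) (qf k m)
       + aV *: dVs (qsm k 0) (qf k 0)))) /\
  ps k.+1 = ps k - dt *:
      (\sum_(1 <= m < p) dVs (qsm k m) (qf k m)
       + aV *: dVs (qsm k 0) (qf k 0)
       + (1 - aV) *: dVs (qsm k p) (qf k p)).

Definition fast_scheme : Prop :=
  forall k m, (k < N)%N -> (m < p)%N ->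
  qf k m.+1 = qf k m + dt *: (invmx Mf *m (pf k m - dt *:
      (aV *: dVf (qsm k m) (qf k m) + aW *: grad W (qf k m)))) /\
  pf k m.+1 = pf k m - dt *:
      (aV *: dVf (qsm k m) (qf k m) + aW *: grad W (qf k m)
       + (1 - aV) *: dVf (qsm k m.+1) (qf k m.+1)
       + (1 - aW) *: grad W (qf k m.+1)).

Definition transformed_slow_scheme (pt : nat -> 'cV[R]_ns) : Prop :=
  forall k, (k < N)%N ->
  [/\ pt k = ps k - dt *:
        (\sum_(1 <= m < p) ((p%:R - m%:R) / p%:R) *: dVs (qsm k m) (qf k m)
         + aV *: dVs (qsm k 0) (qf k 0)),
      qs k.+1 = qs k + DT *: (invmx Ms *m pt k)
    & ps k.+1 = pt k - dt *:
        (\sum_(1 <= m < p) (m%:R / p%:R) *: dVs (qsm k m) (qf k m)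
         + (1 - aV) *: dVs (qsm k p) (qf k p))].

Definition pq_scheme : Prop := slow_scheme /\ fast_scheme.

Definition transformed_pq_scheme : Prop :=
  (exists pt, transformed_slow_scheme pt) /\ fast_scheme.

End Multirate.

(* Main.v *)
Require Import Defs.
From HB Require Import structures.
From mathcomp Require Import all_boot all_order all_algebra.
From mathcomp Require Import all_classical all_reals all_analysis.
From mathcomp Require Import ring.
Set Implicit Arguments.
Unset Strict Implicit.
Unset Printing Implicit Defensive.
Import Order.TTheory GRing.Theory Num.Theory.
Import numFieldNormedType.Exports.
Local Open Scope classical_set_scope.
Local Open Scope ring_scope.

(** Both systems are compared node by node. Computing the partial gradients of
    the discrete Lagrangian turns each pair of momentum equations into
    [p = M v + d a], [p' = M v - d b] with [v] the difference quotient of the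
    configurations; as [M] is invertible, the first equation can be solved for
    the new configuration, and subtracting the two leaves [p' = p - d (a + b)].
    For the slow variables the interpolation weights [(p - m) / p] and [m / p]
    in [a] and [b] add up to 1. *)

(** * Calculus of gradients of scalar functions of a column vector *)

Section Gradient.
Context {R : realType} {n : nat}.
Implicit Types (f : 'cV[R]_n -> R) (x g v : 'cV[R]_n).

Definition dot g v : R := (g^T *m v) 0 0.

Lemma dotE g v : dot g v = \sum_i g i 0 * v i 0.
Proof. by rewrite /dot mxE; apply: eq_bigr => i _; rewrite mxE. Qed.

Lemma dot_delta g i : dot g (delta_mx i 0) = g i 0.
Proof.
rewrite dotE (bigD1 i) //= mxE !eqxx mulr1 big1 ?addr0 // => j /negbTE ji.
by rewrite mxE ji mulr0.
Qed.

(** Since [grad] is total, an equation [grad f x = g] says nothing about differentiability.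
    Packaging both as [is_diff] lets gradients be built up by the differentiation rules; [has_gradE]
    then returns to [grad]. *)
Definition has_grad f x g : Prop := is_diff x f (dot g).

Lemma has_gradE f x g : has_grad f x g -> grad f x = g.
Proof.
by case=> fx dfx; apply/colP => i; rewrite mxE deriveE // dfx dot_delta.
Qed.

(** The differential is linear, hence determined by its values on the [delta_mx i 0], which are the
    partial derivatives. *)
Lemma differentiable_has_grad f x : differentiable f x -> has_grad f x (grad f x).
Proof.
move=> fx; apply: DiffDef => //; apply/funext => v.
rewrite {1}(matrix_sum_delta v) linear_sum dotE; apply: eq_bigr => i _.
by rewrite big_ord1 linearZ mxE deriveE // /= mulrC.
Qed.

(** Used to leave [g] open: the rules below produce some expression for the gradient, which is
    simplified to [g'] afterwards. *)
Lemma has_grad_eq f x g g' : has_grad f x g -> g = g' -> has_grad f x g'.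
Proof. by move=> ? <-. Qed.

Lemma has_grad_cst (c : R) x : has_grad (fun=> c) x 0.
Proof.
apply: (is_diff_eq (is_diff_cst c x)).
by apply/funext => v; rewrite /dot trmx0 mul0mx mxE.
Qed.

Lemma has_gradD f f' x g g' :
  has_grad f x g -> has_grad f' x g' -> has_grad (fun y => f y + f' y) x (g + g').
Proof.
move=> fg fg'; apply: (is_diff_eq (is_diffD fg fg')).
by apply/funext => v; rewrite /dot raddfD mulmxDl mxE.
Qed.

Lemma has_gradZ (c : R) f x g :
  has_grad f x g -> has_grad (fun y => c * f y) x (c *: g).
Proof.
move=> fg; apply: (is_diff_eq (is_diffZ c fg)).
by apply/funext => v; rewrite /dot linearZ -scalemxAl [RHS]mxE.
Qed.

Lemma has_gradB f f' x g g' :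
  has_grad f x g -> has_grad f' x g' -> has_grad (fun y => f y - f' y) x (g - g').
Proof.
move=> fg fg'; apply: (is_diff_eq (is_diffB fg fg')).
by apply/funext => v; rewrite /dot raddfB mulmxBl [RHS]mxE [X in _ = _ + X]mxE.
Qed.

Lemma has_gradM f f' x g g' : has_grad f x g -> has_grad f' x g' ->
  has_grad (fun y => f y * f' y) x (f x *: g' + f' x *: g).
Proof.
move=> fg fg'; apply: (is_diff_eq (is_diffM fg fg')).
apply/funext => v; rewrite /dot linearD !linearZ mulmxDl -!scalemxAl.
by rewrite [RHS]mxE [X in _ = X + _]mxE [X in _ = _ + X]mxE.
Qed.

Lemma has_grad_sum (I : Type) (r : seq I) (F : I -> 'cV[R]_n -> R)
    (G : I -> 'cV[R]_n) x : (forall i, has_grad (F i) x (G i)) ->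
  has_grad (fun y => \sum_(i <- r) F i y) x (\sum_(i <- r) G i).
Proof.
move=> FG; elim: r => [|i r IH].
  by under eq_fun do rewrite big_nil; rewrite big_nil; exact: has_grad_cst.
by under eq_fun do rewrite big_cons; rewrite big_cons; exact: has_gradD.
Qed.

(** A scalar linear part suffices: difference quotients and interpolated positions depend on each
    end point through a dilation and a shift. *)
Lemma has_grad_comp_affine (a : R) f x b g : has_grad f (a *: x + b) g ->
  has_grad (fun y => f (a *: y + b)) x (a *: g).
Proof.
move=> fg.
have ab : is_diff x (fun y => a *: y + b) ( *:%R a).
  apply: (is_diff_eq (is_diffD (is_diff_scaler a x) (is_diff_cst b x))).
  by rewrite addr0.
apply: (is_diff_eq (is_diff_comp ab fg)).
by apply/funext => v; rewrite /dot /= -scalemxAr [in RHS]linearZ -scalemxAl.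
Qed.

Lemma has_grad_coord i x : has_grad (fun y => y i 0) x (delta_mx i 0).
Proof.
have/differentiable_has_grad := @differentiable_coord R n 1 x i 0.
move=> h; apply: (has_grad_eq h).
apply/colP => j; rewrite mxE deriveE; last exact: differentiable_coord.
(* The coordinate is repackaged as a continuous linear map, so that it is its own differential. *)
have lc : linear (fun y : 'cV[R]_n => y i 0 : R^o) by move=> a u v; rewrite !mxE.
pose c := GRing.isLinear.Build R _ _ _ _ lc.
pose l : {linear 'cV[R]_n -> R^o} := HB.pack (fun y : 'cV[R]_n => y i 0 : R^o) c.
rewrite -[(fun y : 'cV[R]_n => _)]/(l : 'cV[R]_n -> R) diff_lin /=; last first.
  exact: coord_continuous.
by rewrite !mxE eq_sym.
Qed.

Lemma has_grad_quad (M : 'M[R]_n) x : M^T = M ->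
  has_grad (quad M) x (2 *: (M *m x)).
Proof.
move=> Msym.
have -> : quad M = (fun y => \sum_i \sum_j M j i * (y j 0 * y i 0)).
  apply/funext => y; rewrite /quad mxE; apply: eq_bigr => i _.
  rewrite mxE big_distrl; apply: eq_bigr => j _ /=.
  by rewrite mxE mulrA [M j i * _]mulrC.
apply: has_grad_eq.
  apply: has_grad_sum => i; apply: has_grad_sum => j.
  by apply/has_gradZ/has_gradM; exact: has_grad_coord.
apply/colP => k.
rewrite !mxE summxE.
under eq_bigr do (rewrite summxE; under eq_bigr do
  rewrite !mxE eqxx !andbT mulrDr).
under eq_bigr do rewrite big_split /=.
rewrite big_split /= [X in _ + X]exchange_big /=.
(* The product rule leaves two double sums with Kronecker deltas. Collapsing them gives column [k]
   of [M] and row [k] of [M] applied to [x]; symmetry of [M] makes these equal, whence the factor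
   2. *)
have E (F : 'I_n -> 'I_n -> R) : \sum_i \sum_j F i j * (k == i)%:R = \sum_j F k j.
  rewrite (bigD1 k) //= eqxx [X in _ + X]big1 ?addr0; last first.
    by move=> i ik; rewrite big1 // => j _; rewrite eq_sym (negbTE ik) mulr0.
  by apply: eq_bigr => j _; rewrite mulr1.
under eq_bigr do under eq_bigr do rewrite mulrA.
under [X in _ + X]eq_bigr do under eq_bigr do rewrite mulrA.
rewrite !E mulr_natl mulr2n; congr (_ + _); apply: eq_bigr => j _ //.
by rewrite -{1}Msym mxE.
Qed.

End Gradient.

Lemma smooth_on_differentiable (R : realType) (E : normedModType R) (U : set E)
  (f : E -> R) x : smooth_on U f -> U x -> differentiable f x.
Proof. by move=> /(_ 1%N) [+ _]; apply. Qed.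

(** * Kinetic energy of a difference quotient *)

Section KineticGradient.
Context {R : realType} {n : nat}.
Variables (c d : R) (M : 'M[R]_n) (q q' : 'cV[R]_n).
Hypothesis Msym : M^T = M.

(** Here [c] is the length weighting the energy and [d] the length in the difference quotient. Both
    are later [DT] (slow) or [dt] (fast), which turns [c / d] into 1. *)
Lemma has_grad_kineticr :
  has_grad (fun x => c / 2 * quad M (d^-1 *: (x - q))) q'
    ((c / d) *: (M *m (d^-1 *: (q' - q)))).
Proof.
have E x : d^-1 *: (x - q) = d^-1 *: x + - (d^-1 *: q) by rewrite scalerBr.
under eq_fun do rewrite E.
apply: has_grad_eq.
  by apply/has_gradZ/has_grad_comp_affine/has_grad_quad.
rewrite -E !scalerA; congr (_ *: _).
(* With [d^-1] abstracted, [field] does not ask for [d != 0]. *)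
by set e := d^-1; field.
Qed.

Lemma has_grad_kineticl :
  has_grad (fun x => c / 2 * quad M (d^-1 *: (q' - x))) q
    (- ((c / d) *: (M *m (d^-1 *: (q' - q))))).
Proof.
have E x : d^-1 *: (q' - x) = (- d^-1) *: x + d^-1 *: q'.
  by rewrite scalerBr scaleNr addrC.
under eq_fun do rewrite E.
apply: has_grad_eq.
  by apply/has_gradZ/has_grad_comp_affine/has_grad_quad.
rewrite -E !scalerA -scaleNr; congr (_ *: _).
by set e := d^-1; field.
Qed.

End KineticGradient.

(** * Potentials at interpolated nodes *)

Section PotentialGradient.
Context {R : realType} {ns nf : nat} (V : 'cV[R]_ns * 'cV[R]_nf -> R).

Lemma has_grad_dVs x y : differentiable V (x, y) ->
  has_grad (fun x' => V (x', y)) x (dVs V x y).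
Proof.
move=> dV; apply: differentiable_has_grad.
apply: (@differentiable_comp _ _ _ _ (fun x' => (x', y)) V) => //.
Qed.

Lemma has_grad_dVf x y : differentiable V (x, y) ->
  has_grad (fun y' => V (x, y')) y (dVf V x y).
Proof.
move=> dV; apply: differentiable_has_grad.
apply: (@differentiable_comp _ _ _ _ (fun y' => (x, y')) V) => //.
Qed.

Variables (p : nat) (q q' : 'cV[R]_ns) (y : 'cV[R]_nf) (m : nat).
Hypothesis dV : differentiable V (interp p q q' m, y).

(** This form is affine in each end point separately; its coefficients are the weights that the
    chain rule puts on the slow forces. *)
Lemma interpE x x' :
  interp p x x' m = (1 - m%:R / p%:R) *: x + (m%:R / p%:R) *: x' :> 'cV[R]_ns.
Proof. by rewrite /interp scalerBr scalerBl scale1r addrA addrAC. Qed.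

Lemma has_grad_interpl :
  has_grad (fun x => V (interp p x q' m, y)) q
    ((1 - m%:R / p%:R) *: dVs V (interp p q q' m) y).
Proof.
under eq_fun do rewrite interpE.
apply: (has_grad_comp_affine (f := fun z => V (z, y))); rewrite -interpE.
exact: has_grad_dVs.
Qed.

Lemma has_grad_interpr :
  has_grad (fun x => V (interp p q x m, y)) q'
    ((m%:R / p%:R) *: dVs V (interp p q q' m) y).
Proof.
under eq_fun do rewrite interpE addrC.
apply: (has_grad_comp_affine (f := fun z => V (z, y))).
rewrite addrC -interpE.
exact: has_grad_dVs.
Qed.

End PotentialGradient.

(** An interior node collects [1 - a] from the interval on its left and [a] from the one on its
    right, in total 1; the two extreme nodes keep a single share. For [p = 0] the right side would
    be [F 0] instead of 0. *)
Lemma trapezoid_sum (R : realType) (U : lmodType R) (a : R) (F : nat -> U) p :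
  (0 < p)%N ->
  \sum_(m < p) (a *: F m + (1 - a) *: F m.+1)
  = \sum_(1 <= m < p) F m + a *: F 0%N + (1 - a) *: F p.
Proof.
case: p => // p _; elim: p => [|p IH].
  by rewrite big_ord1 big_geq // add0r.
rewrite big_ord_recr IH /= [in RHS]big_nat_recr //= addrA; congr (_ + _).
by rewrite -addrA -scalerDl subrK scale1r addrAC.
Qed.

(** * Discrete momenta of the multirate Lagrangian *)

Section LagrangianGradient.
Context {R : realType} {ns nf : nat}.
Variables (p : nat) (dt : R).
Variables (Ms : 'M[R]_ns) (Mf : 'M[R]_nf).
Variables (V : 'cV[R]_ns * 'cV[R]_nf -> R) (W : 'cV[R]_nf -> R).
Variables (aV aW : R) (q q' : 'cV[R]_ns) (y : nat -> 'cV[R]_nf).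
Hypotheses (p_gt0 : (0 < p)%N) (dt_neq0 : dt != 0).
Hypotheses (Ms_sym : Ms^T = Ms) (Mf_sym : Mf^T = Mf).
Hypothesis dV : forall m, (m <= p)%N -> differentiable V (interp p q q' m, y m).
Hypothesis dW : forall m, (m <= p)%N -> differentiable W (y m).

Let Vs m := dVs V (interp p q q' m) (y m).
Let Vf m := dVf V (interp p q q' m) (y m).

Lemma DT_neq0 : DT p dt != 0.
Proof. by rewrite mulf_neq0 // pnatr_eq0 -lt0n. Qed.

Lemma grad_Ldl :
  grad (fun x => Ld p dt Ms Mf V W aV aW x q' y) q
  = - (Ms *m ((DT p dt)^-1 *: (q' - q))
       + dt *: (\sum_(1 <= m < p) ((p%:R - m%:R) / p%:R) *: Vs m + aV *: Vs 0%N)).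
Proof.
have p_neq0 : p%:R != 0 :> R by rewrite pnatr_eq0 -lt0n.
apply: has_gradE; apply: has_grad_eq.
  apply: has_gradB; last exact: has_grad_cst.
  apply: has_gradB.
    by apply: has_gradD; [exact: has_grad_kineticl | exact: has_grad_cst].
  apply: has_grad_sum => m; apply/has_gradZ/has_gradD; apply: has_gradZ;
    apply: has_grad_interpl; apply: dV => //; exact: ltnW.
rewrite subr0 addr0 divff ?DT_neq0 // scale1r -scaler_sumr -opprD.
(* This weight is 1 at [m = 0] and 0 at [m = p], so the term of the last node vanishes. *)
pose F m := (1 - m%:R / p%:R) *: Vs m.
rewrite (trapezoid_sum aV F p_gt0) /F divff // mul0r subrr subr0 scale0r scaler0.
rewrite scale1r addr0.
rewrite (eq_bigr (fun m => ((p%:R - m%:R) / p%:R) *: Vs m)) // => m _.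
by rewrite mulrBl divff.
Qed.

Lemma grad_Ldr :
  grad (fun x => Ld p dt Ms Mf V W aV aW q x y) q'
  = Ms *m ((DT p dt)^-1 *: (q' - q))
    - dt *: (\sum_(1 <= m < p) (m%:R / p%:R) *: Vs m + (1 - aV) *: Vs p).
Proof.
have p_neq0 : p%:R != 0 :> R by rewrite pnatr_eq0 -lt0n.
apply: has_gradE; apply: has_grad_eq.
  apply: has_gradB; last exact: has_grad_cst.
  apply: has_gradB.
    by apply: has_gradD; [exact: has_grad_kineticr | exact: has_grad_cst].
  apply: has_grad_sum => m; apply/has_gradZ/has_gradD; apply: has_gradZ;
    apply: has_grad_interpr; apply: dV => //; exact: ltnW.
rewrite subr0 addr0 divff ?DT_neq0 // scale1r -scaler_sumr.
(* Here the weight vanishes at [m = 0] and is 1 at [m = p], so the term of the first node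
   disappears. *)
pose F m := (m%:R / p%:R) *: Vs m.
rewrite (trapezoid_sum aV F p_gt0) /F divff // mul0r scale0r scaler0 scale1r.
by rewrite addr0.
Qed.

Variables (m : nat) (m_lt : (m < p)%N).

(** The node [y m] enters only the fast difference quotient and the [aV] and [aW] terms; the share
    of slow kinetic energy is constant in it. *)
Lemma grad_Ldml :
  grad (fun z => Ldm p dt Ms Mf V W aV aW q q' m z (y m.+1)) (y m)
  = - (Mf *m (dt^-1 *: (y m.+1 - y m))
       + dt *: (aV *: Vf m + aW *: grad W (y m))).
Proof.
apply: has_gradE; apply: has_grad_eq.
  apply: has_gradB; last first.
    apply/has_gradZ/has_gradD; last exact: has_grad_cst.
    by apply/has_gradZ/differentiable_has_grad/dW/ltnW.
  apply: has_gradB; last first.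
    apply/has_gradZ/has_gradD; last exact: has_grad_cst.
    by apply/has_gradZ/has_grad_dVf/dV/ltnW.
  by apply: has_gradD; [exact: has_grad_cst | exact: has_grad_kineticl].
by rewrite add0r !addr0 divff // scale1r -addrA -!opprD -scalerDr.
Qed.

Lemma grad_Ldmr :
  grad (fun z => Ldm p dt Ms Mf V W aV aW q q' m (y m) z) (y m.+1)
  = Mf *m (dt^-1 *: (y m.+1 - y m))
    - dt *: ((1 - aV) *: Vf m.+1 + (1 - aW) *: grad W (y m.+1)).
Proof.
apply: has_gradE; apply: has_grad_eq.
  apply: has_gradB; last first.
    apply/has_gradZ/has_gradD; first exact: has_grad_cst.
    by apply/has_gradZ/differentiable_has_grad/dW.
  apply: has_gradB; last first.
    apply/has_gradZ/has_gradD; first exact: has_grad_cst.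
    by apply/has_gradZ/has_grad_dVf/dV.
  by apply: has_gradD; [exact: has_grad_cst | exact: has_grad_kineticr].
by rewrite !add0r divff // scale1r -addrA -!opprD -scalerDr.
Qed.

End LagrangianGradient.

(** Two step sizes are kept apart because the slow equations have [c = DT] but [d = dt]; in the fast
    ones both are [dt]. *)
Lemma momentum_step_iff (R : realType) (n : nat) (M : 'M[R]_n) (c d : R)
    (q q' p p' a b : 'cV[R]_n) : M \in unitmx -> c != 0 ->
  (p = M *m (c^-1 *: (q' - q)) + d *: a /\ p' = M *m (c^-1 *: (q' - q)) - d *: b)
  <-> (q' = q + c *: (invmx M *m (p - d *: a)) /\ p' = p - d *: (a + b)).
Proof.
move=> Mu c0.
have E : p = M *m (c^-1 *: (q' - q)) + d *: a
    <-> q' = q + c *: (invmx M *m (p - d *: a)).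
  split=> ->.
    by rewrite addrK mulKmx // scalerA divff // scale1r addrC subrK.
  by rewrite [q + _]addrC addrK scalerA mulVf // scale1r mulKVmx // subrK.
split=> -[H ->].
  by split; [exact/E | rewrite H [d *: (a + b)]scalerDr opprD addrA addrK].
split; first exact/E.
(* The momentum form of the first equation is recovered before the common kinetic term can be
   matched in the second. *)
by rewrite (E.2 H) [d *: (a + b)]scalerDr opprD addrA addrK.
Qed.

Theorem theorem3p5 (R : realType) (ns nf : nat)
  (Qs : set 'cV[R]_ns) (Qf : set 'cV[R]_nf)
  (open_Qs : open Qs) (open_Qf : open Qf)
  (Ms : 'M[R]_ns) (Mf : 'M[R]_nf)
  (Ms_sym : Ms^T = Ms) (Ms_unit : Ms \in unitmx)
  (Mf_sym : Mf^T = Mf) (Mf_unit : Mf \in unitmx)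
  (V : 'cV[R]_ns * 'cV[R]_nf -> R) (W : 'cV[R]_nf -> R)
  (V_smooth : smooth_on (Qs `*` Qf) V) (W_smooth : smooth_on Qf W)
  (p : nat) (p_gt0 : (0 < p)%N) (dt : R) (dt_gt0 : 0 < dt)
  (aV aW : R) (aV01 : 0 <= aV <= 1) (aW01 : 0 <= aW <= 1)
  (N : nat)
  (qs : nat -> 'cV[R]_ns) (qf : nat -> nat -> 'cV[R]_nf)
  (ps : nat -> 'cV[R]_ns) (pf : nat -> nat -> 'cV[R]_nf)
  (qs_in : forall k, (k <= N)%N -> Qs (qs k))
  (qsm_in : forall k m, (k < N)%N -> (m <= p)%N ->
     Qs (interp p (qs k) (qs k.+1) m))
  (qf_in : forall k m, (k < N)%N -> (m <= p)%N -> Qf (qf k m))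
  (qf_glue : forall k, (k.+1 < N)%N -> qf k p = qf k.+1 0%N)
  (pf_glue : forall k, (k.+1 < N)%N -> pf k p = pf k.+1 0%N) :
  (momentum_form p dt Ms Mf V W aV aW N qs qf ps pf
     <-> pq_scheme p dt Ms Mf V W aV aW N qs qf ps pf) /\
  (momentum_form p dt Ms Mf V W aV aW N qs qf ps pf
     <-> transformed_pq_scheme p dt Ms Mf V W aV aW N qs qf ps pf).

Proof.
have dt0 : dt != 0 by rewrite gt_eqF.
have DT0 : DT p dt != 0 by exact: DT_neq0.
have dV k m : (k < N)%N -> (m <= p)%N ->
    differentiable V (interp p (qs k) (qs k.+1) m, qf k m).
  move=> kN mp; apply: (smooth_on_differentiable V_smooth).
  by split; [exact: qsm_in | exact: qf_in].
have dW k m : (k < N)%N -> (m <= p)%N -> differentiable W (qf k m).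
  by move=> kN mp; apply: (smooth_on_differentiable W_smooth); exact: qf_in.
pose Vs k m := dVs V (interp p (qs k) (qs k.+1) m) (qf k m).
pose Vf k m := dVf V (interp p (qs k) (qs k.+1) m) (qf k m).
(* The left and right forces, slow and fast, that play the roles of [a] and [b] in
   [momentum_step_iff]. *)
pose sl k := \sum_(1 <= m < p) ((p%:R - m%:R) / p%:R) *: Vs k m + aV *: Vs k 0%N.
pose sr k := \sum_(1 <= m < p) (m%:R / p%:R) *: Vs k m + (1 - aV) *: Vs k p.
pose fl k m := aV *: Vf k m + aW *: grad W (qf k m).
pose fr k m := (1 - aV) *: Vf k m.+1 + (1 - aW) *: grad W (qf k m.+1).
have slE k : sl k + sr k
    = \sum_(1 <= m < p) Vs k m + aV *: Vs k 0%N + (1 - aV) *: Vs k p.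
  rewrite /sl /sr addrACA -big_split addrA; congr (_ + _ + _).
  apply: eq_bigr => m _ /=.
  by rewrite -scalerDl -mulrDl subrK divff ?scale1r // pnatr_eq0 -lt0n.
have flE k m : fl k m + fr k m = aV *: Vf k m + aW *: grad W (qf k m)
    + (1 - aV) *: Vf k m.+1 + (1 - aW) *: grad W (qf k m.+1).
  by rewrite /fl /fr addrA.
have slow_iff k : (k < N)%N ->
    (ps k = - grad (fun x => Ld p dt Ms Mf V W aV aW x (qs k.+1) (qf k)) (qs k) /\
     ps k.+1 = grad (fun x => Ld p dt Ms Mf V W aV aW (qs k) x (qf k)) (qs k.+1))
    <-> (qs k.+1 = qs k + DT p dt *: (invmx Ms *m (ps k - dt *: sl k)) /\
         ps k.+1 = ps k - dt *: (sl k + sr k)).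
  move=> kN; have dVk m mp := dV k m kN mp.
  by rewrite grad_Ldl // grad_Ldr // opprK; exact: momentum_step_iff.
have fast_iff k m : (k < N)%N -> (m < p)%N ->
    (pf k m = - grad (fun y => Ldm p dt Ms Mf V W aV aW (qs k) (qs k.+1) m y
                                 (qf k m.+1)) (qf k m) /\
     pf k m.+1 = grad (fun y => Ldm p dt Ms Mf V W aV aW (qs k) (qs k.+1) m
                                 (qf k m) y) (qf k m.+1))
    <-> (qf k m.+1 = qf k m + dt *: (invmx Mf *m (pf k m - dt *: fl k m)) /\
         pf k m.+1 = pf k m - dt *: (fl k m + fr k m)).
  move=> kN mp; have dVk i ip := dV k i kN ip; have dWk i ip := dW k i kN ip.
  by rewrite grad_Ldml // grad_Ldmr // opprK; exact: momentum_step_iff.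
have momentum_pq : momentum_form p dt Ms Mf V W aV aW N qs qf ps pf
    <-> pq_scheme p dt Ms Mf V W aV aW N qs qf ps pf.
  split=> [H | [Hs Hf] k kN].
    split=> [qsm k kN | qsm k m kN mp].
      by have [Hl Hr _] := H k kN; rewrite -slE; apply/(slow_iff k kN).
    by have [_ _ /(_ m mp)/(fast_iff k m kN mp)] := H k kN; rewrite flE.
  have := (slow_iff k kN).2; rewrite slE => /(_ (Hs k kN)) [? ?].
  split=> // m mp; apply/(fast_iff k m kN mp); rewrite flE; exact: Hf.
(* The fast part is shared, so only the two slow parts remain to be compared. *)
split=> //; rewrite momentum_pq.
split=> -[Hs Hf]; split=> //.
  (* The intermediate momentum is [ps k] after the left force alone; the right force then completes
     the update. *)
  exists (fun k => ps k - dt *: sl k) => k kN; have [Hq Hp] := Hs k kN.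
  have E : ps k.+1 = ps k - dt *: (sl k + sr k) by rewrite slE; exact: Hp.
  rewrite scalerDr opprD addrA in E.
  exact: (And3 erefl Hq E).
(* Conversely, the first transformed equation determines [pt k], and substituting it eliminates the
   auxiliary momentum. *)
move=> k kN; have [pt /(_ k kN) [pE Hq Hp]] := Hs.
have ptE : pt k = ps k - dt *: sl k := pE.
have E : ps k.+1 = pt k - dt *: sr k := Hp.
rewrite ptE -addrA -opprD -scalerDr slE in E.
by rewrite ptE in Hq; exact: (conj Hq E).
Qed.
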